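(* Let $\Phi=(\varphi_n)_n$ be a frame for $\mathcal H$ with lower frame bound $m_\Phi$, and let the Bessel sequence $\Psi=(\psi_n)_n$ be a $\mu$-perturbation of $\Phi$, where $0<\mu<\sqrt{m_\Phi}$. Then $\Psi$ is a frame for $\mathcal H$ with lower frame bound $(\sqrt{m_\Phi}-\mu)^2$. Moreover, for each $\Theta\in \mathrm{ran}_{B(\mathcal H,\ell^2)}(T_\Phi)$ and all operators $\mathcal A_1,\mathcal A_2\in B(\mathcal H)$ with $\|Id_{\mathcal H}-\mathcal A_i\|_{\rm op}<1$ ($i=1,2$), setting $\Theta_{ba}:=P_{\ker(T_\Psi)}U_{\Phi^{ad}_\Theta(\mathcal A_1)}$, the approximate dual $\Psi^{ad}_{\Theta_{ba}}(\mathcal A_2)$ of $\Psi$ is a best approximation of $\Phi^{ad}_\Theta(\mathcal A_1)$ with respect to the norm $\|\cdot\|_{\mathfrak{Fr}}$, and it is a $\lambda$-perturbation of $\Phi^{ad}_\Theta(\mathcal A_1)$, where $$\lambda=\frac{\mu}{\sqrt{m_\Phi}-\mu}\Big(\frac{\|\mathcal A_1\|_{\rm op}}{\sqrt{m_\Phi}}+\|\Theta\|_{\rm op}+\frac{\|\mathcal A_1-\mathcal A_2\|_{\rm op}}{\mu}\Big).$$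
   Context: $\mathcal H$ is a separable Hilbert space, $\ell^2=\ell^2(\mathbb N)$ with canonical orthonormal basis $(\delta_n)_n$, and $\|\cdot\|_{\rm op}$ is the operator norm. A sequence $\Phi=(\varphi_n)_{n\in\mathbb N}$ in $\mathcal H$ is a frame with (lower, upper) bounds $m_\Phi,M_\Phi>0$ if $m_\Phi\|f\|^2\le\sum_n|\langle f,\varphi_n\rangle|^2\le M_\Phi\|f\|^2$ for all $f\in\mathcal H$; it is a Bessel sequence if the right inequality holds. For a Bessel sequence $\Phi$: the analysis operator is $U_\Phi:\mathcal H\to\ell^2$, $U_\Phi f=(\langle f,\varphi_n\rangle)_n$; the synthesis operator is $T_\Phi=U_\Phi^*$, $T_\Phi c=\sum_n c_n\varphi_n$; the frame operator is $S_\Phi=T_\Phi U_\Phi$; and $\|\Phi\|_{\mathfrak{Fr}}:=\|T_\Phi\|_{\rm op}$. Differences of sequences are taken componentwise. A Bessel sequence $\Psi$ is a $\mu$-perturbation of $\Phi$ if $\|\Phi-\Psi\|_{\mathfrak{Fr}}=\|T_\Phi-T_\Psi\|_{\rm op}\le\mu$. For a frame $\Phi$, $\mathrm{ran}_{B(\mathcal H,\ell^2)}(T_\Phi):=\{\Theta\in B(\mathcal H,\ell^2): T_\Phi\Theta=0\}$. For $\mathcal A\in B(\mathcal H)$ with $\|Id_{\mathcal H}-\mathcal A\|_{\rm op}<1$ and $\Theta\in\mathrm{ran}_{B(\mathcal H,\ell^2)}(T_\Phi)$, $\Phi^{ad}_\Theta(\mathcal A)$ denotes the sequence $\big(\mathcal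 A^*S_\Phi^{-1}\varphi_n+\Theta^*\delta_n\big)_n$. (These are exactly the approximately dual frames of $\Phi$, i.e. the Bessel sequences $\Phi^{ad}$ with $\|Id_{\mathcal H}-T_\Phi U_{\Phi^{ad}}\|_{\rm op}<1$, and $T_\Phi U_{\Phi^{ad}_\Theta(\mathcal A)}=\mathcal A$.) $P_X$ is the orthogonal projection of $\ell^2$ onto the closed subspace $X$. ''$\Psi^{ad}_{\Theta_{ba}}(\mathcal A_2)$ is a best approximation of $\Phi^{ad}_\Theta(\mathcal A_1)$ with respect to $\|\cdot\|_{\mathfrak{Fr}}$'' means: for all $\Lambda\in\mathrm{ran}_{B(\mathcal H,\ell^2)}(T_\Psi)$, $\|\Psi^{ad}_{\Theta_{ba}}(\mathcal A_2)-\Phi^{ad}_\Theta(\mathcal A_1)\|_{\mathfrak{Fr}}\le\|\Psi^{ad}_{\Lambda}(\mathcal A_2)-\Phi^{ad}_\Theta(\mathcal A_1)\|_{\mathfrak{Fr}}$. *)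

(* Defs.v *)
From HB Require Import structures.
From mathcomp Require Import all_boot all_order all_algebra.
From mathcomp Require Import all_classical all_reals all_analysis.
From mathcomp Require Import complex.
From mathcomp Require Import ring lra.

Set Implicit Arguments.
Unset Strict Implicit.
Unset Printing Implicit Defensive.

Import Order.TTheory GRing.Theory Num.Theory.
Import numFieldNormedType.Exports.

Local Open Scope classical_set_scope.
Local Open Scope ring_scope.

Variant scalar_kind := RealScalars | ComplexScalars.

Definition RorC (R : realType) (k : scalar_kind) : numFieldType :=
  match k with RealScalars => R | ComplexScalars => R[i] end.

Section Scalars.
Variables (R : realType) (k : scalar_kind).
Local Notation K := (RorC R k).

Definition conjK : K -> K :=
  match k return RorC R k -> RorC R k with
  | RealScalars => id | ComplexScalars => @conjc R
  end.

Definition reK : K -> R :=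
  match k return RorC R k -> R with
  | RealScalars => id | ComplexScalars => @complex.Re R
  end.

Definition imK : K -> R :=
  match k return RorC R k -> R with
  | RealScalars => fun=> 0 | ComplexScalars => @complex.Im R
  end.

Definition ofR : R -> K :=
  match k return R -> RorC R k with
  | RealScalars => id | ComplexScalars => real_complex R
  end.

(* The imaginary unit, and 0 over the reals *)
Definition iK : K :=
  match k return RorC R k with
  | RealScalars => 0 | ComplexScalars => Complex 0 1
  end.

Lemma conjK_zmod_morphism : zmod_morphism conjK.
Proof. by rewrite /conjK; case: k => // x y; rewrite rmorphB. Qed.

Lemma conjK_monoid_morphism : monoid_morphism conjK.
Proof.
rewrite /conjK; case: k; first by [].
by split; [exact: rmorph1 | exact: rmorphM].
Qed.

HB.instance Definition _ := GRing.isZmodMorphism.Build K K conjK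
  conjK_zmod_morphism.
HB.instance Definition _ := GRing.isMonoidMorphism.Build K K conjK
  conjK_monoid_morphism.

Lemma reK_zmod_morphism : zmod_morphism reK.
Proof. by rewrite /reK; case: k => // -[a b] [c d]. Qed.

HB.instance Definition _ := GRing.isZmodMorphism.Build K R reK
  reK_zmod_morphism.

Lemma imK_zmod_morphism : zmod_morphism imK.
Proof. by rewrite /imK; case: k => [x y|[a b] [c d] //]; rewrite subr0. Qed.

HB.instance Definition _ := GRing.isZmodMorphism.Build K R imK
  imK_zmod_morphism.

Lemma ofR_zmod_morphism : zmod_morphism ofR.
Proof. by rewrite /ofR; case: k => // x y; rewrite rmorphB. Qed.

Lemma ofR_monoid_morphism : monoid_morphism ofR.
Proof.
rewrite /ofR; case: k; first by [].
by split; [exact: rmorph1 | exact: rmorphM].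
Qed.

HB.instance Definition _ := GRing.isZmodMorphism.Build R K ofR
  ofR_zmod_morphism.
HB.instance Definition _ := GRing.isMonoidMorphism.Build R K ofR
  ofR_monoid_morphism.

Lemma conjK_involutive : involutive conjK.
Proof. by rewrite /conjK; case: k => // x; rewrite conjcK. Qed.

Lemma mul_conjK (z : K) : z * conjK z = `|z| ^+ 2.
Proof.
rewrite /conjK; case: k z => [x|z]; last by rewrite sqr_normc.
by rewrite real_normK ?num_real.
Qed.

Lemma normr_conjK (z : K) : `|conjK z| = `|z|.
Proof. by rewrite /conjK; case: k z => // z; rewrite normcJ. Qed.

Lemma ofRK : cancel ofR reK.
Proof. by rewrite /ofR /reK; case: k. Qed.

Lemma ler_ofR (x y : R) : (ofR x <= ofR y) = (x <= y).
Proof. by rewrite /ofR; case: k => //; rewrite lecR. Qed.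

Lemma ltr_ofR (x y : R) : (ofR x < ofR y) = (x < y).
Proof. by rewrite /ofR; case: k => //; rewrite ltcR. Qed.

Lemma normr_ofR (x : R) : `|ofR x| = ofR `|x|.
Proof.
rewrite /ofR; case: k => //.
by rewrite normc_def /= expr0n addr0 sqrtr_sqr.
Qed.

Lemma ger0_reK (z : K) : 0 <= z -> ofR (reK z) = z.
Proof.
rewrite /ofR /reK; case: k z => // z z0.
by rewrite RRe_real // ger0_real.
Qed.

Lemma K_split (z : K) : z = ofR (reK z) + iK * ofR (imK z).
Proof.
rewrite /ofR /reK /imK /iK; case: k z => [x|z]; first by rewrite mul0r addr0.
exact: complexE.
Qed.

Lemma normr_iK : `|iK| <= 1.
Proof.
rewrite /iK; case: k; first by rewrite normr0.
by rewrite normc_def /= expr0n expr1n add0r sqrtr1.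
Qed.

Definition rnorm (V : normedZmodType K) (x : V) : R := reK `|x|.

Lemma ofR_rnorm (V : normedZmodType K) (x : V) : ofR (rnorm x) = `|x|.
Proof. by rewrite /rnorm ger0_reK. Qed.

Lemma rnorm_ge0 (V : normedZmodType K) (x : V) : 0 <= rnorm x.
Proof. by rewrite -ler_ofR ofR_rnorm rmorph0. Qed.

Lemma normr_reK_le (z : K) : `|reK z| <= rnorm z.
Proof.
rewrite -ler_ofR ofR_rnorm /ofR /reK; case: k z => // z.
exact: normc_ge_Re.
Qed.

Lemma normr_imK_le (z : K) : `|imK z| <= rnorm z.
Proof.
rewrite -ler_ofR ofR_rnorm /ofR /imK; case: k z => [z|z]; first by rewrite normr0.
rewrite normc_def lecR -sqrtr_sqr ler_sqrt ?lerDr ?sqr_ge0 //.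
by rewrite addr_ge0 ?sqr_ge0.
Qed.

Lemma addr_conjK (z : K) : z + conjK z = ofR (reK z *+ 2).
Proof.
rewrite /conjK /ofR /reK; case: k z => [z|z]; first by rewrite mulr2n.
by rewrite addcJ mulr2n rmorphD /= mulrDl mul1r.
Qed.

End Scalars.

Arguments conjK {R k}.
Arguments reK {R k}.
Arguments imK {R k}.
Arguments ofR {R k}.
Arguments iK {R k}.

Section ScalarSeries.
Variables (R : realType) (k : scalar_kind).
Local Notation K := (RorC R k).

Lemma cvg_ofR (u : nat -> R) (l : R) :
  u @ \oo --> l -> (fun n => ofR (u n) : K) @ \oo --> (ofR l : K).
Proof.
move=> ul; apply/cvgrPdist_lt => e e0.
have re0 : 0 < reK e.
  by rewrite -(@ltr_ofR R k) rmorph0 ger0_reK ?ltW.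
move/cvgrPdist_lt : ul => /(_ _ re0); apply: filterS => n nlt.
by rewrite -rmorphB normr_ofR -[e]ger0_reK ?ltW // ltr_ofR.
Qed.

Lemma cvg_conjK (u : nat -> K) (l : K) :
  u @ \oo --> l -> (fun n => conjK (u n)) @ \oo --> conjK l.
Proof.
move=> ul; apply/cvgrPdist_lt => e e0.
move/cvgrPdist_lt : ul => /(_ _ e0); apply: filterS => n.
by rewrite -rmorphB normr_conjK.
Qed.

Lemma is_cvg_series_rnorm (a : nat -> K) :
  cvgn (series (fun n => rnorm (a n))) -> cvgn (series a).
Proof.
move=> ca.
have cvR (f : K -> R) : (forall z, `|f z| <= rnorm z) ->
    cvgn (series (fun n => f (a n))).
  move=> fle; apply: (@normed_cvg R R^o).
  by apply: series_le_cvg ca => n; rewrite ?normr_ge0 ?rnorm_ge0 ?fle.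
have /cvg_ex[s ss] := cvR _ (@normr_reK_le R k).
have /cvg_ex[t tt] := cvR _ (@normr_imK_le R k).
apply/cvg_ex; exists (ofR s + iK * ofR t).
have -> : series a = (fun n => ofR (series (fun n => reK (a n)) n) +
    iK * ofR (series (fun n => imK (a n)) n)).
  apply/funext => n; rewrite /series /= !rmorph_sum mulr_sumr -big_split /=.
  by apply: eq_bigr => i _; exact: K_split.
apply: cvgD; first exact: cvg_ofR.
by apply: cvgM; [exact: cvg_cst | exact: cvg_ofR].
Qed.

End ScalarSeries.

Section DotTheory.
Variables (R : realType) (k : scalar_kind).
Local Notation K := (RorC R k).
Variables (V : lmodType K) (form : {dot V for @conjK R k}).

Lemma dotC u v : form u v = conjK (form v u).
Proof. by rewrite (hermC form u v) expr0 mul1r. Qed.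

Lemma dot_ge0 u : 0 <= form u u.
Proof.
have [->|u0] := eqVneq u 0; first by rewrite linear0r.
by rewrite ltW // neq0_dnorm_gt0.
Qed.

Lemma dot_eq0 u : form u u = 0 -> u = 0.
Proof.
have [->//|u0] := eqVneq u 0.
have /gt_eqF/eqP// : 0 < form u u by exact: neq0_dnorm_gt0.
Qed.

Lemma dot_CauchySchwarz u v : `|form u v| ^+ 2 <= form u u * form v v.
Proof.
have [->|v0] := eqVneq v 0; first by rewrite linear0r normr0 expr0n mulr_ge0 ?dot_ge0.
have vv : 0 < form v v by exact: neq0_dnorm_gt0.
pose a := form u v / form v v; pose w := u - a *: v.
have wv : form w v = 0.
  by rewrite /w linearBl linearZl_LR /= /a divfK ?gt_eqF // subrr.
have := dot_ge0 w; rewrite {2}/w linearBr linearZr_LR /= wv mulr0 subr0.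
rewrite /w linearBl linearZl_LR /= /a (dotC v u) mulrAC mul_conjK subr_ge0.
by rewrite ler_pdivrMr.
Qed.

Definition dnorm (u : V) : K := ofR (Num.sqrt (reK (form u u))).

Lemma sqr_dnorm u : dnorm u ^+ 2 = form u u.
Proof.
rewrite /dnorm -rmorphXn /= sqr_sqrtr ?ger0_reK ?dot_ge0 //.
by rewrite -(@ler_ofR R k) ger0_reK ?dot_ge0 // rmorph0 dot_ge0.
Qed.

Lemma dnorm_ge0 u : 0 <= dnorm u.
Proof. by rewrite /dnorm -(rmorph0 (@ofR R k)) ler_ofR sqrtr_ge0. Qed.

Lemma dnorm_eq0 u : dnorm u = 0 -> u = 0.
Proof. by move=> u0; apply: dot_eq0; rewrite -sqr_dnorm u0 expr0n. Qed.

Lemma dnormZ (a : K) u : dnorm (a *: u) = `|a| * dnorm u.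
Proof.
apply/eqP; rewrite -(@eqrXn2 _ 2) ?mulr_ge0 ?dnorm_ge0 //.
rewrite exprMn !sqr_dnorm linearZl_LR linearZr_LR /=.
by rewrite mulrA mul_conjK.
Qed.

Lemma ler_dnormD u v : dnorm (u + v) <= dnorm u + dnorm v.
Proof.
rewrite -(@ler_pXn2r _ 2) ?nnegrE ?addr_ge0 ?dnorm_ge0 //.
rewrite sqrrD !sqr_dnorm linearDl !linearDr /=.
rewrite [leLHS](_ : _ = form u u + (form u v + conjK (form u v)) + form v v); last first.
  by rewrite -(dotC v u) !addrA.
rewrite lerD2r lerD2l addr_conjK rmorphMn lerMn2r /=.
apply: le_trans (_ : `|form u v| <= _).
  rewrite -ofR_rnorm ler_ofR; exact: le_trans (ler_norm _) (normr_reK_le _).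
rewrite -(@ler_pXn2r _ 2) ?nnegrE ?mulr_ge0 ?dnorm_ge0 //.
by rewrite exprMn !sqr_dnorm dot_CauchySchwarz.
Qed.

End DotTheory.

HB.mixin Record hasInnerProduct (R : realType) (k : scalar_kind) V
    & NormedModule (RorC R k) V := {
  inner : {dot V for @conjK R k};
  sqr_norm_inner : forall x : V, `|x| ^+ 2 = inner x x
}.

#[short(type="innerProductType")]
HB.structure Definition InnerProduct (R : realType) (k : scalar_kind) :=
  {V of NormedModule (RorC R k) V & hasInnerProduct R k V}.

#[short(type="hilbertType")]
HB.structure Definition Hilbert (R : realType) (k : scalar_kind) :=
  {V of InnerProduct R k V & Complete V}.

Definition sqsummable (R : realType) (k : scalar_kind) : {pred nat -> RorC R k} :=
  fun a => `[< (\sum_(0 <= n <oo) (rnorm (a n) ^+ 2)%:E < +oo)%E >].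
Arguments sqsummable {R k}.

Section SquareSummable.
Variables (R : realType) (k : scalar_kind).
Local Notation K := (RorC R k).
Implicit Types a b : nat -> K.

Lemma rnormM (x y : K) : rnorm (x * y) = rnorm x * rnorm y.
Proof.
by apply: (can_inj (@ofRK R k)); rewrite rmorphM /= !ofR_rnorm normrM.
Qed.

Lemma rnorm_sqrD (x y : K) :
  rnorm (x + y) ^+ 2 <= 2 * rnorm x ^+ 2 + 2 * rnorm y ^+ 2.
Proof.
have h : rnorm (x + y) <= rnorm x + rnorm y.
  by rewrite -(@ler_ofR R k) rmorphD /= !ofR_rnorm ler_normD.
apply: le_trans (_ : (rnorm x + rnorm y) ^+ 2 <= _).
  by rewrite ler_pXn2r ?nnegrE ?addr_ge0 ?rnorm_ge0.
rewrite -subr_ge0 [leRHS](_ : _ = (rnorm x - rnorm y) ^+ 2) ?sqr_ge0 //.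
by ring.
Qed.

Lemma sqsummable_submod_closed : submod_closed (@sqsummable R k).
Proof.
split=> [|x a b /asboolP sa /asboolP sb]; apply/asboolP.
  rewrite eseries0 ?ltry // => n _ _.
  by rewrite /rnorm normr0 raddf0 expr0n.
pose c : R := 2 * rnorm x ^+ 2.
apply: (@le_lt_trans _ _ (\sum_(0 <= n <oo)
    (c%:E * (rnorm (a n) ^+ 2)%:E + 2%:E * (rnorm (b n) ^+ 2)%:E))%E).
  apply: lee_nneseries => [n _ _|n _]; first by rewrite lee_fin sqr_ge0.
  rewrite -!EFinM -EFinD lee_fin.
  rewrite (le_trans (rnorm_sqrD _ _)) //.
  by rewrite /c -mulrA -exprMn -rnormM.
have c0 : 0 <= c by rewrite /c mulr_ge0 ?sqr_ge0.
rewrite nneseriesD; last 2 first.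
- by move=> n _ _; rewrite mule_ge0 // lee_fin ?sqr_ge0.
- by move=> n _ _; rewrite mule_ge0 // lee_fin ?sqr_ge0.
rewrite !nneseriesZl; last 2 first.
- by move=> n _; rewrite lee_fin sqr_ge0.
- by move=> n _; rewrite lee_fin sqr_ge0.
by rewrite lte_add_pinfty // lte_mul_pinfty ?lee_fin.
Qed.

HB.instance Definition _ :=
  GRing.isSubmodClosed.Build K (nat -> K) (@sqsummable R k)
    sqsummable_submod_closed.

Lemma is_cvg_sqsummable a : a \in sqsummable ->
  cvgn (series (fun n => rnorm (a n) ^+ 2)).
Proof.
move=> /asboolP sa; apply: nondecreasing_is_cvgn.
  by apply: nondecreasing_series => n _ _; rewrite sqr_ge0.
have pos n : (0 <= n)%N -> true -> (0 <= (rnorm (a n) ^+ 2)%:E)%E.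
  by rewrite lee_fin sqr_ge0.
exists (fine (\sum_(0 <= n <oo) (rnorm (a n) ^+ 2)%:E)%E) => _ [n _ <-].
rewrite -lee_fin fineK; last first.
  by rewrite ge0_fin_numE // nneseries_ge0.
by rewrite /series /= -sumEFin; exact: nneseries_lim_ge.
Qed.

Lemma is_cvg_inner_series a b : a \in sqsummable -> b \in sqsummable ->
  cvgn (series (fun n => a n * conjK (b n))).
Proof.
move=> sa sb; apply: is_cvg_series_rnorm.
pose c n := rnorm (a n) ^+ 2 + rnorm (b n) ^+ 2.
apply: (@series_le_cvg _ _ c) => [n|n|n|].
- exact: rnorm_ge0.
- by rewrite addr_ge0 ?sqr_ge0.
- rewrite rnormM [rnorm (conjK _)]/rnorm normr_conjK -/(rnorm _).
  have := sqr_ge0 (rnorm (a n) - rnorm (b n)).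
  have := mulr_ge0 (rnorm_ge0 (a n)) (rnorm_ge0 (b n)).
  rewrite /c; nra.
- have := is_cvg_seriesD (is_cvg_sqsummable sa) (is_cvg_sqsummable sb).
  by [].
Qed.

End SquareSummable.

Record ell2 (R : realType) (k : scalar_kind) := Ell2 {
  ell2_val :> nat -> RorC R k;
  ell2_subproof : ell2_val \in sqsummable }.

Section Ell2.
Variables (R : realType) (k : scalar_kind).
Local Notation K := (RorC R k).
Local Notation ell2 := (ell2 R k).

HB.instance Definition _ := [isSub for @ell2_val R k].
HB.instance Definition _ := [Choice of ell2 by <:].
HB.instance Definition _ := [SubChoice_isSubLmodule of ell2 by <:].

Definition ell2_inner (a b : ell2) : K :=
  limn (series (fun n => a n * conjK (b n))).

Lemma ell2_inner_cvg (a b : ell2) :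
  series (fun n => a n * conjK (b n)) @ \oo --> ell2_inner a b.
Proof. exact: is_cvg_inner_series (ell2_subproof a) (ell2_subproof b). Qed.

Lemma ell2_innerE (a b : ell2) (l : K) :
  series (fun n => a n * conjK (b n)) @ \oo --> l -> ell2_inner a b = l.
Proof. by move=> h; exact: cvg_lim h. Qed.

Lemma ell2_innerC (a b : ell2) : ell2_inner a b = conjK (ell2_inner b a).
Proof.
apply: ell2_innerE.
rewrite [series _](_ : _ =
  fun n => conjK (series (fun n => b n * conjK (a n)) n)); last first.
  apply/funext => n; rewrite /series /= rmorph_sum /=; apply: eq_bigr => i _.
  by rewrite rmorphM /= conjK_involutive mulrC.
by apply: cvg_conjK; exact: ell2_inner_cvg.
Qed.

Lemma ell2_inner_linear (b : ell2) :
  linear_for *%R (fun a => ell2_inner a b).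
Proof.
move=> x a a'; apply: ell2_innerE.
rewrite [series _](_ : _ =
  fun n => x * series (fun n => a n * conjK (b n)) n +
     series (fun n => a' n * conjK (b n)) n); last first.
  apply/funext => n; rewrite /series /= mulr_sumr -big_split /=.
  apply: eq_bigr => i _.
  by rewrite mulrA -mulrDl.
apply: cvgD; last exact: ell2_inner_cvg.
by apply: cvgM; [exact: cvg_cst | exact: ell2_inner_cvg].
Qed.

Lemma ell2_inner_bilinear :
  (forall b, zmod_morphism (ell2_inner^~ b)) /\
  (forall a, zmod_morphism (ell2_inner a)) /\
  (forall b, scalable_for *%R (ell2_inner^~ b)) /\
  (forall a, scalable_for (@conjK R k \; *%R) (ell2_inner a)).
Proof.
have addl b : zmod_morphism (ell2_inner^~ b).
  exact: zmod_morphism_linear (ell2_inner_linear b).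
have scl b : scalable_for *%R (ell2_inner^~ b).
  exact: scalable_linear (ell2_inner_linear b).
split => //; split; last split => //.
- move=> a b b'; rewrite ell2_innerC (addl a) rmorphB /=.
  by rewrite -!(ell2_innerC a).
- by move=> a x b; rewrite ell2_innerC scl rmorphM /= -(ell2_innerC a).
Qed.

HB.instance Definition _ :=
  isBilinear.Build K ell2 ell2 K *%R (@conjK R k \; *%R) ell2_inner
    ell2_inner_bilinear.1 ell2_inner_bilinear.2.1
    ell2_inner_bilinear.2.2.1 ell2_inner_bilinear.2.2.2.

Lemma ell2_inner_hermitian (a b : ell2) :
  ell2_inner a b = (-1) ^+ false * conjK (ell2_inner b a).
Proof. by rewrite expr0 mul1r ell2_innerC. Qed.

HB.instance Definition _ :=
  isHermitianSesquilinear.Build K ell2 false (@conjK R k) ell2_inner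
    ell2_inner_hermitian.

Lemma ell2_inner_gt0 (a : ell2) : a != 0 -> 0 < ell2_inner a a.
Proof.
move=> a0.
have ca := is_cvg_sqsummable (ell2_subproof a).
have -> : ell2_inner a a = ofR (limn (series (fun n => rnorm (a n) ^+ 2))).
  apply: ell2_innerE.
  rewrite [series _](_ : _ =
    fun n => ofR (series (fun n => rnorm (a n) ^+ 2) n)); last first.
    apply/funext => n; rewrite /series /= rmorph_sum /=; apply: eq_bigr => i _.
    by rewrite mul_conjK rmorphXn /= ofR_rnorm.
  exact: cvg_ofR.
rewrite -(rmorph0 (@ofR R k)) ltr_ofR.
have [n an0] : exists n, a n != 0.
  apply: contrapT => /forallNP h; move/eqP : a0; apply; apply: val_inj.
  by apply/funext => n; apply/eqP; apply/negbNE/negP; exact: h.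
have nd : nondecreasing_seq (series (fun n => rnorm (a n) ^+ 2)).
  by apply: nondecreasing_series => m _ _; rewrite sqr_ge0.
apply: lt_le_trans (nondecreasing_cvgn_le nd ca n.+1).
rewrite seriesSr ltr_wpDl //.
  by rewrite /series /=; apply: sumr_ge0 => i _; rewrite sqr_ge0.
by rewrite exprn_gt0 // -(@ltr_ofR R k) rmorph0 ofR_rnorm normr_gt0.
Qed.

HB.instance Definition _ :=
  isDotProduct.Build K ell2 ell2_inner ell2_inner_gt0.

Definition ell2_dot : {dot ell2 for @conjK R k} := ell2_inner.

HB.instance Definition _ :=
  Lmodule_isNormed.Build K ell2 (ler_dnormD ell2_dot) (dnormZ ell2_dot)
    (@dnorm_eq0 R k ell2 ell2_dot).

Lemma ell2_sqr_norm (a : ell2) : `|a| ^+ 2 = ell2_dot a a.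
Proof. exact: sqr_dnorm. Qed.

HB.instance Definition _ := hasInnerProduct.Build R k ell2 ell2_sqr_norm.

End Ell2.

Section Operators.
Variables (R : realType) (k : scalar_kind).

Definition separable (H : innerProductType R k) : Prop :=
  exists2 D : set H, countable D & dense D.

Definition bounded_operators (V W : innerProductType R k) : set (V -> W) :=
  [set f | linear f /\ continuous f].

Definition opnorm (V W : innerProductType R k) (f : V -> W) : R :=
  sup [set rnorm (f x) | x in [set x : V | rnorm x <= 1]].

(* The junk value 0 is taken when [f] has no adjoint; every bounded operator
   whose domain is a Hilbert space has one, and it is unique *)
Definition adjoint (V W : innerProductType R k) (f : V -> W) : W -> V :=
  xget (fun=> 0) [set g | forall x y, inner (f x) y = inner x (g y)].

Definition null_space (V W : innerProductType R k) (f : V -> W) : set V :=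
  f @^-1` [set 0].

Definition orthoproj (V : innerProductType R k) (X : set V) (x : V) : V :=
  xget 0 [set p | X p /\ forall y, X y -> inner (x - p) y = 0].

End Operators.

Section CanonicalBasis.
Variables (R : realType) (k : scalar_kind).

Lemma delta_sqsummable (n : nat) :
  (fun m => (m == n)%:R : RorC R k) \in sqsummable.
Proof.
apply/asboolP; rewrite (@nneseriesD1 _ _ n) //; last first.
  by move=> m _; rewrite lee_fin sqr_ge0.
rewrite eseries0 ?adde0 ?ltry // => m _ /= /negbTE ->.
by rewrite /rnorm normr0 raddf0 expr0n.
Qed.

Definition delta (n : nat) : ell2 R k := Ell2 (delta_sqsummable n).

End CanonicalBasis.

Section Frames.
Variables (R : realType) (k : scalar_kind) (H : hilbertType R k).
Implicit Types (Phi Psi : nat -> H) (m M mu : R).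

Definition lower_bound m Phi : Prop := forall f : H,
  ((m * rnorm f ^+ 2)%:E <=
     \sum_(0 <= n <oo) (rnorm (inner f (Phi n)) ^+ 2)%:E)%E.

Definition upper_bound M Phi : Prop := forall f : H,
  (\sum_(0 <= n <oo) (rnorm (inner f (Phi n)) ^+ 2)%:E <=
     (M * rnorm f ^+ 2)%:E)%E.

Definition bessel Phi : Prop := exists2 M, 0 < M & upper_bound M Phi.

Definition frame_bounds m M Phi : Prop :=
  [/\ 0 < m, 0 < M, lower_bound m Phi & upper_bound M Phi].

Definition frame_with_lower_bound m Phi : Prop :=
  exists M, frame_bounds m M Phi.

(* [insubd] sends a sequence that is not square-summable, which does not occur
   when [Phi] is Bessel, to 0; see [analysisE] *)
Definition analysis Phi (f : H) : ell2 R k :=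
  insubd (0 : ell2 R k) (fun n => inner f (Phi n)).

Lemma analysisE Phi f n : bessel Phi -> analysis Phi f n = inner f (Phi n).
Proof.
move=> [M _ /(_ f) leM]; rewrite /analysis.
have sf : (fun n => inner f (Phi n)) \in sqsummable.
  by apply/asboolP; rewrite (le_lt_trans leM) // ltry.
by rewrite -[LHS]/(val _ n) (insubdK _ sf).
Qed.

Definition synthesis Phi : ell2 R k -> H := adjoint (analysis Phi).

Definition frame_operator Phi : H -> H := synthesis Phi \o analysis Phi.

Definition frnorm Phi : R := opnorm (synthesis Phi).

Definition perturbation mu Phi Psi : Prop :=
  [/\ bessel Phi, bessel Psi & frnorm (Phi - Psi) <= mu].

(* The operators written ran_{B(H, l^2)}(T_Phi) *)
Definition synthesis_ran Phi : set (H -> ell2 R k) :=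
  [set Th | bounded_operators Th /\ forall f, synthesis Phi (Th f) = 0].

Definition inv_op (f : H -> H) : H -> H := 'pinv_(fun=> 0) setT f.

Definition approx_dual Phi (Th : H -> ell2 R k) (A : H -> H) : nat -> H :=
  fun n => adjoint A (inv_op (frame_operator Phi) (Phi n)) +
           adjoint Th (delta R k n).

Definition approximately_dual Phi Psi : Prop :=
  bessel Psi /\ opnorm (fun f => f - synthesis Phi (analysis Psi f)) < 1.

Definition best_approximation Psi (Th : H -> ell2 R k) (A : H -> H) Phi : Prop :=
  synthesis_ran Psi Th /\
  forall L, synthesis_ran Psi L ->
    frnorm (approx_dual Psi Th A - Phi) <= frnorm (approx_dual Psi L A - Phi).

End Frames.

(* Main.v *)
From HB Require Import structures.
Require Import Defs.
From mathcomp Require Import all_boot all_order all_algebra.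
From mathcomp Require Import all_classical all_reals all_analysis.
From mathcomp Require Import ring lra.

Import Order.TTheory GRing.Theory Num.Theory.
Import numFieldNormedType.Exports.

Local Open Scope classical_set_scope.
Local Open Scope ring_scope.

Set Implicit Arguments.
Unset Strict Implicit.
Unset Printing Implicit Defensive.

(** Write [U] and [T] for analysis and synthesis operators and [S = T U]. A frame
    with lower bound [m] satisfies [sqrt m |f| <= |U f|], so the triangle
    inequality gives [(sqrt m - mu) |f| <= |U_Psi f|] for a [mu]-perturbation
    (lemma [perturbation_analysis_ge]): [Psi] is a frame.

    For a frame, coercivity of the form [<U x, U y>] makes [S] bijective
    ([coercive_representation], a variational form of the Riesz and Lax-Milgram
    theorems, which also provides all the adjoints). Then [G = U S^-1] satisfies
    [T G = 1] and [|G f| <= c^-1 |f|] whenever [c |f| <= |U f|], the map [G T] is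
    the orthogonal projection onto the range of [U], and [1 - G T] is the
    projection onto the kernel of [T] ([orthoproj_ker_synthesis]).

    The approximate dual with parameters [Theta] and [A] has analysis operator
    [G A + Theta] ([approx_dual_analysis]). Let [U_ad] be the analysis operator of
    the approximate dual of [Phi], so that [T_Phi U_ad = A1]. For any [L] with
    [T_Psi L = 0], the projection [G_Psi T_Psi] maps [G_Psi A2 + L - U_ad] to
    [G_Psi (A2 - T_Psi U_ad)], which is exactly the difference obtained when [L] is
    the kernel part of [U_ad] ([approx_dual_ker_proj_sub]). As the projection is a
    contraction, this choice is pointwise optimal
    ([approx_dual_ker_proj_best]). Finally
    [A2 - T_Psi U_ad = (A2 - A1) + (T_Phi - T_Psi) U_ad] has norm at most
    [|A1 - A2| + mu (|A1| / sqrt m + |Theta|)], and [G_Psi] has norm at most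
    [(sqrt m - mu)^-1]; the product is [lambda]. Norms of sequences are computed on
    analysis operators, since an operator and its adjoint have the same norm. *)

(** * Real norms and inner products *)

Section Scalars.
Variables (R : realType) (k : scalar_kind).
Local Notation K := (RorC R k).

Lemma reK_ofRM (a : R) (z : K) : reK (ofR a * z) = a * reK z.
Proof.
by rewrite /reK /ofR; case: k z => // -[x y] /=; rewrite mul0r subr0.
Qed.

Lemma rnorm_ofR (a : R) : rnorm (ofR a : K) = `|a|.
Proof. by rewrite /rnorm normr_ofR ofRK. Qed.

Section NormedZmodule.
Variable V : normedZmodType K.
Implicit Types x y : V.

Lemma rnorm0 : rnorm (0 : V) = 0.
Proof. by rewrite /rnorm normr0 raddf0. Qed.

Lemma rnorm_eq0 x : (rnorm x == 0) = (x == 0).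
Proof.
by rewrite -(inj_eq (can_inj (@ofRK R k))) ofR_rnorm rmorph0 normr_eq0.
Qed.

Lemma rnormN x : rnorm (- x) = rnorm x.
Proof. by rewrite /rnorm normrN. Qed.

Lemma rnorm_distrC x y : rnorm (x - y) = rnorm (y - x).
Proof. by rewrite -rnormN opprB. Qed.

Lemma ler_rnormD x y : rnorm (x + y) <= rnorm x + rnorm y.
Proof. by rewrite -(@ler_ofR R k) rmorphD /= !ofR_rnorm ler_normD. Qed.

Lemma ler_rnormB x y : rnorm (x - y) <= rnorm x + rnorm y.
Proof. by rewrite (le_trans (ler_rnormD _ _)) ?rnormN. Qed.

End NormedZmodule.

Lemma rnormZ (V : normedModType K) (a : K) (x : V) :
  rnorm (a *: x) = rnorm a * rnorm x.
Proof.
by apply: (can_inj (@ofRK R k)); rewrite rmorphM /= !ofR_rnorm normrZ.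
Qed.

End Scalars.

Section InnerProduct.
Variables (R : realType) (k : scalar_kind) (V : innerProductType R k).
Local Notation K := (RorC R k).
Implicit Types x y z : V.

Lemma innerC x y : inner x y = conjK (inner y x).
Proof. exact: dotC. Qed.

Lemma innerDl x y z : inner (x + y) z = inner x z + inner y z.
Proof. by rewrite linearDl. Qed.

Lemma innerDr x y z : inner z (x + y) = inner z x + inner z y.
Proof. by rewrite linearDr. Qed.

Lemma innerBl x y z : inner (x - y) z = inner x z - inner y z.
Proof. by rewrite linearBl. Qed.

Lemma innerBr x y z : inner z (x - y) = inner z x - inner z y.
Proof. by rewrite linearBr. Qed.

Lemma innerZl (a : K) x z : inner (a *: x) z = a * inner x z.
Proof. by rewrite linearZl_LR. Qed.

Lemma innerZr (a : K) x z : inner z (a *: x) = conjK a * inner z x.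
Proof. by rewrite linearZr_LR. Qed.

Lemma reK_innerC x y : reK (inner x y) = reK (inner y x).
Proof. by rewrite innerC /reK /conjK; case: k (inner y x) => // -[]. Qed.

Lemma inner_self x : inner x x = ofR (rnorm x ^+ 2).
Proof. by rewrite -sqr_norm_inner rmorphXn /= ofR_rnorm. Qed.

Lemma reK_inner_self x : reK (inner x x) = rnorm x ^+ 2.
Proof. by rewrite inner_self ofRK. Qed.

Lemma rnorm_inner_le x y : rnorm (inner x y) <= rnorm x * rnorm y.
Proof.
rewrite -(@ler_pXn2r _ 2) ?nnegrE ?mulr_ge0 ?rnorm_ge0 // -(@ler_ofR R k).
rewrite exprMn [leRHS]rmorphM /= -!inner_self rmorphXn /= ofR_rnorm.
exact: dot_CauchySchwarz.
Qed.

Lemma reK_inner_le x y : reK (inner x y) <= rnorm x * rnorm y.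
Proof.
apply: le_trans (rnorm_inner_le x y).
exact: le_trans (ler_norm _) (normr_reK_le _).
Qed.

Lemma sqr_rnormD x y :
  rnorm (x + y) ^+ 2 = rnorm x ^+ 2 + 2 * reK (inner x y) + rnorm y ^+ 2.
Proof.
rewrite -!reK_inner_self innerDl !innerDr !raddfD /= (reK_innerC y x); ring.
Qed.

Lemma parallelogram x y :
  rnorm (x - y) ^+ 2 + rnorm (x + y) ^+ 2 =
  2 * rnorm x ^+ 2 + 2 * rnorm y ^+ 2.
Proof.
rewrite -!reK_inner_self innerBl !innerBr innerDl !innerDr !(raddfB, raddfD) /=.
ring.
Qed.

Lemma inner_inj x y : (forall z, inner z x = inner z y) -> x = y.
Proof.
move=> h; apply/eqP; rewrite -subr_eq0; apply/eqP/(@dot_eq0 _ _ _ inner).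
by rewrite [LHS]innerBr h subrr.
Qed.

End InnerProduct.

(** * Bounded linear maps *)

(** The operator norm bound in a form that does not presuppose that the
    supremum defining [opnorm] is finite. *)
Definition norm_bound (R : realType) (k : scalar_kind)
    (V W : normedModType (RorC R k)) (c : R) (f : V -> W) : Prop :=
  forall x, rnorm (f x) <= c * rnorm x.

Section LinearMaps.
Variables (R : realType) (k : scalar_kind).
Local Notation K := (RorC R k).

Section Linear.
Variables (V W : lmodType K) (f : V -> W) (lf : linear f).

Lemma linear_subE x y : f (x - y) = f x - f y.
Proof. exact: (zmod_morphism_linear lf). Qed.

Lemma linear_addE x y : f (x + y) = f x + f y.
Proof. by have := lf 1 x y; rewrite !scale1r. Qed.

Lemma linear_scaleE a x : f (a *: x) = a *: f x.
Proof. exact: (scalable_linear lf). Qed.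

Lemma linear_zeroE : f 0 = 0.
Proof. by rewrite -[0 in LHS](subrr 0) linear_subE subrr. Qed.

End Linear.

Section Bounded.
Variables (V W : innerProductType R k).
Implicit Types f g : V -> W.

Lemma norm_bound_continuous c f : linear f -> norm_bound c f -> continuous f.
Proof.
move=> lf fc.
pose fL : {linear V -> W} := HB.pack f (GRing.isLinear.Build _ _ _ _ f lf).
have : bounded_near fL (nbhs (0 : V)).
  apply/linear_boundedP; near=> r => x.
  rewrite -[`|x|]ofR_rnorm -[`|_|]ofR_rnorm.
  apply: (@le_trans _ _ (ofR `|c| * ofR (rnorm x))).
    rewrite -rmorphM ler_ofR (le_trans (fc x)) //.
    by rewrite ler_wpM2r ?rnorm_ge0 ?ler_norm.
  rewrite ler_wpM2r //; first by rewrite ofR_rnorm.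
  near: r; apply: nbhs_pinfty_ge; rewrite realE.
  by rewrite -(rmorph0 (@ofR R k)) ler_ofR normr_ge0.
by move/linear_bounded_continuous.
Unshelve. all: by end_near. Qed.

Lemma continuous_norm_bound f : linear f -> continuous f ->
  exists2 c, 0 < c & norm_bound c f.
Proof.
move=> lf cf.
pose fL : {linear V -> W} := HB.pack f (GRing.isLinear.Build _ _ _ _ f lf).
have /linear_bounded_continuous/linear_boundedP hb : continuous fL by [].
have [c [c0 hc]] : exists c : K, 0 < c /\ forall x : V, `|fL x| <= c * `|x|.
  near (pinfty_nbhs K) => r; exists r; split; near: r; last exact: hb.
  exact: nbhs_pinfty_gt.
have rc : ofR (reK c) = c by rewrite ger0_reK // ltW.
exists (reK c); first by rewrite -(@ltr_ofR R k) rc rmorph0.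
move=> x; rewrite -(@ler_ofR R k) rmorphM /= rc !ofR_rnorm; exact: hc.
Unshelve. all: by end_near. Qed.

Lemma opnorm_le f c : 0 <= c -> norm_bound c f -> opnorm f <= c.
Proof.
move=> c0 fc; apply: ge_sup.
  by exists (rnorm (f 0)), 0 => //=; rewrite rnorm0.
move=> _ [x /= x1 <-]; apply: le_trans (fc x) _.
by rewrite -[leRHS]mulr1 ler_wpM2l.
Qed.

Lemma rnorm_le_opnorm c f x : norm_bound c f -> rnorm x <= 1 ->
  rnorm (f x) <= opnorm f.
Proof.
move=> fc x1; apply: sup_upper_bound; last by exists x.
split; first by exists (rnorm (f x)), x.
exists `|c| => _ [y /= y1 <-]; apply: le_trans (fc y) _.
apply: (@le_trans _ _ (`|c| * rnorm y)).
  by rewrite ler_wpM2r ?rnorm_ge0 ?ler_norm.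
by rewrite -[leRHS]mulr1 ler_wpM2l.
Qed.

Lemma opnorm_ge0 c f : norm_bound c f -> 0 <= opnorm f.
Proof.
move=> fc; apply: le_trans (rnorm_ge0 (f 0)) _.
by apply: rnorm_le_opnorm fc _; rewrite rnorm0.
Qed.

Lemma norm_bound_opnorm c f : linear f -> norm_bound c f ->
  norm_bound (opnorm f) f.
Proof.
move=> lf fc x.
have [->|x0] := eqVneq x 0; first by rewrite linear_zeroE // !rnorm0 mulr0.
have nx : 0 < rnorm x by rewrite lt_neqAle eq_sym rnorm_eq0 x0 rnorm_ge0.
have nV : rnorm (ofR (rnorm x)^-1 : K) = (rnorm x)^-1.
  by rewrite rnorm_ofR ger0_norm // invr_ge0 rnorm_ge0.
rewrite -ler_pdivrMr // mulrC -nV -rnormZ -linear_scaleE //.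
by apply: rnorm_le_opnorm fc _; rewrite rnormZ nV mulVf ?gt_eqF.
Qed.

End Bounded.

Lemma bounded_operatorsP (V W : innerProductType R k) (f : V -> W) :
  bounded_operators f <-> linear f /\ exists2 c, 0 < c & norm_bound c f.
Proof.
split=> [[lf cf]|[lf [c _ fc]]]; split => //.
  exact: continuous_norm_bound.
exact: norm_bound_continuous fc.
Qed.

End LinearMaps.

(** * Riesz representation and adjoints *)

Section Variational.
Variables (R : realType) (k : scalar_kind).
Variables (H : hilbertType R k) (W : innerProductType R k).
Local Notation K := (RorC R k).

(** Optimising over [t] turns an almost vanishing first variation into a bound
    on its linear coefficient. *)
Lemma quadratic_ge0_linear_coef (a b e : R) : 0 < e -> 0 <= b ->
  (forall t, 0 <= e ^+ 2 + 2 * t * a + t ^+ 2 * b ^+ 2) -> a <= e * b.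
Proof.
move=> e0 b0 h; have [a0|a0] := leP a 0.
  by rewrite (le_trans a0) ?mulr_ge0 ?(ltW e0).
have [b00|b00] := eqVneq b 0.
  have := h (- e ^+ 2 / a); rewrite b00.
  have -> : e ^+ 2 + 2 * (- e ^+ 2 / a) * a + (- e ^+ 2 / a) ^+ 2 * 0 ^+ 2 = - e ^+ 2.
    by field; rewrite gt_eqF.
  by rewrite oppr_ge0 leNgt exprn_gt0.
have b2 : 0 < b ^+ 2 by rewrite exprn_gt0 // lt_neqAle eq_sym b00 b0.
rewrite -(@ler_pXn2r _ 2) ?nnegrE ?(ltW a0) ?mulr_ge0 ?(ltW e0) //.
have := h (- a / b ^+ 2).
have -> : e ^+ 2 + 2 * (- a / b ^+ 2) * a + (- a / b ^+ 2) ^+ 2 * b ^+ 2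
    = e ^+ 2 - a ^+ 2 / b ^+ 2 by field.
by rewrite subr_ge0 ler_pdivrMr // exprMn.
Qed.

(** A bounded functional is represented by the form
    [inner (U x) (U y)] as soon as that form is bounded and coercive. For
    [U = id] this is the Riesz theorem; for [U] the analysis operator of a frame
    it gives the surjectivity of the frame operator. The representing vector
    minimises [|U x|^2 - 2 Re (l x)]: the parallelogram identity makes minimising
    sequences Cauchy, and the first variation vanishes at their limit. *)
Lemma coercive_representation (U : H -> W) (l : H -> K) (c C D : R) :
  linear U -> linear_for *%R l -> 0 < c -> 0 <= C -> 0 <= D ->
  (forall x, c * rnorm x <= rnorm (U x)) -> norm_bound C U ->
  (forall x, rnorm (l x) <= D * rnorm x) ->
  exists u, forall x, l x = inner (U x) (U u).
Proof.
move=> lU ll c0 C0 D0 cU UC lD.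
have lZ := scalable_linear ll.
have lA x y : l (x + y) = l x + l y by have := ll 1 x y; rewrite scale1r mul1r.
pose J x := rnorm (U x) ^+ 2 - 2 * reK (l x).
have Jlb x : - (D / c) ^+ 2 <= J x.
  have h : reK (l x) <= D / c * rnorm (U x).
    apply: le_trans (le_trans (ler_norm _) (normr_reK_le _)) _.
    apply: le_trans (lD x) _.
    by rewrite -mulrA ler_wpM2l // ler_pdivlMl.
  have := sqr_ge0 (rnorm (U x) - D / c); rewrite /J; move: (D / c) h => d h.
  by move=> sq; nra.
have hinf : has_inf (range J).
  split; first by exists (J 0), 0.
  by exists (- (D / c) ^+ 2) => _ [x _ <-].
pose j := inf (range J).
have jle x : j <= J x by apply: ge_inf; [case: hinf | exists x].
(* parallelogram identity, with [j] a lower bound at the midpoint of x and y *)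
have mid x y : rnorm (U (x - y)) ^+ 2 <= 2 * (J x - j) + 2 * (J y - j).
  have := jle (ofR 2^-1 *: (x + y)); rewrite /J.
  rewrite linear_scaleE // lZ rnormZ reK_ofRM rnorm_ofR linear_addE // lA raddfD /=.
  rewrite linear_subE // ger0_norm ?invr_ge0 //.
  have := parallelogram (U x) (U y).
  move: (rnorm _) (rnorm (U x + _)) => p q; rewrite exprMn => pq.
  have -> : 2^-1 ^+ 2 = 4^-1 :> R by field.
  lra.
have /choice[x_ xj] : forall n : nat, exists x, J x < j + n.+1%:R^-1.
  move=> n; have [|_ [x _ <-] ?] := @inf_adherent _ _ n.+1%:R^-1 _ hinf => //.
  by exists x.
have : exists u : H, x_ @ \oo --> u.
  suff /cauchy_cvg/cvg_ex : cauchy (x_ @ \oo) by [].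
  apply/cauchyP => e e0.
  have re0 : 0 < reK e by rewrite -(@ltr_ofR R k) rmorph0 ger0_reK // ltW.
  have ce : 0 < (c * reK e) ^+ 2 / 4 by rewrite divr_gt0 ?exprn_gt0 ?mulr_gt0.
  have [N _ hN] := near_infty_natSinv_lt (PosNum ce).
  have {}hN n : (N <= n)%N -> n.+1%:R^-1 < (c * reK e) ^+ 2 / 4 by exact: hN.
  exists (x_ N); exists N => // n /= Nn.
  rewrite -ball_normE /= -ofR_rnorm -[e]ger0_reK ?ltW // ltr_ofR.
  rewrite -(@ltr_pM2l _ c) //; apply: le_lt_trans (cU _) _.
  rewrite -(@ltr_pXn2r _ 2) ?nnegrE ?mulr_ge0 ?rnorm_ge0 ?ltW //.
  apply: le_lt_trans (mid _ _) _.
  have := hN _ Nn; have := hN _ (leqnn N); have := xj n; have := xj N.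
  move: (J (x_ N)) (J (x_ n)) ((c * reK e) ^+ 2) (_%:R^-1) (_%:R^-1) => /= *.
  lra.
case=> u xu; exists u.
(* the first variation of [J] at [u] in the direction [v], up to any [e > 0] *)
have key v : reK (inner (U v) (U u)) - reK (l v) <= 0.
  apply/ler_addgt0Pr => e e0; rewrite add0r.
  pose b := rnorm (U v).
  have b0 : 0 <= b by exact: rnorm_ge0.
  (* [d] satisfies [d b + b (C d) <= e]; the [+ 1] allows [b = 0] *)
  pose d := e / ((1 + C) * (b + 1)).
  have q0 : 0 < (1 + C) * (b + 1) by apply: mulr_gt0; [exact: ltr_pwDl|exact: ltr_wpDl].
  have d0 : 0 < d by rewrite divr_gt0.
  have d20 : 0 < d ^+ 2 by rewrite exprn_gt0.
  have [n [nd nu]] : exists n, n.+1%:R^-1 < d ^+ 2 /\ rnorm (u - x_ n) < d.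
    near \oo => n; exists n; split; near: n.
      exact: (near_infty_natSinv_lt (PosNum d20)).
    have d0' : 0 < (ofR d : K) by rewrite -(rmorph0 (@ofR R k)) ltr_ofR.
    move/cvgrPdist_lt : xu => /(_ _ d0'); apply: filterS => n.
    by rewrite -ofR_rnorm ltr_ofR.
  have h1 : reK (inner (U v) (U (x_ n))) - reK (l v) <= d * b.
    apply: quadratic_ge0_linear_coef => // t.
    have := jle (x_ n + ofR t *: v); have := xj n; rewrite /J.
    rewrite linear_addE // linear_scaleE // sqr_rnormD rnormZ rnorm_ofR exprMn.
    rewrite real_normK ?num_real // reK_innerC innerZl reK_ofRM lA lZ raddfD /=.
    rewrite reK_ofRM -/b.
    move: (reK (inner _ _)) (reK (l (x_ n))) (reK (l v)) (_%:R^-1) nd => p q r w nd.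
    move: (rnorm _ ^+ 2) (d ^+ 2) (b ^+ 2) (t ^+ 2) nd => *; nra.
  have h2 : reK (inner (U v) (U (u - x_ n))) <= b * (C * d).
    apply: le_trans (reK_inner_le _ _) _; rewrite ler_wpM2l //.
    by apply: le_trans (UC _) _; rewrite ler_wpM2l // ltW.
  have h3 : d * b + b * (C * d) <= e.
    have -> : e = d * ((1 + C) * (b + 1)) by rewrite /d divfK ?gt_eqF.
    by have := mulr_ge0 C0 (ltW d0); nra.
  apply: le_trans h3; move: h1 h2; rewrite linear_subE // innerBr raddfB /=.
  lra.
move=> x; apply/eqP; rewrite eq_sym -subr_eq0 -rnorm_eq0.
pose g := inner (U x) (U u) - l x; rewrite -/g.
(* rotating [x] by the conjugate of [g] controls [g] by a real part *)
have := key (conjK g *: x).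
rewrite -raddfB linear_scaleE // lZ innerZl -mulrBr -/g mulrC mul_conjK.
rewrite -ofR_rnorm -rmorphXn /= ofRK => h.
by rewrite -sqrf_eq0 eq_le h sqr_ge0.
Unshelve. all: by end_near. Qed.

End Variational.

Section Adjoint.
Variables (R : realType) (k : scalar_kind).
Variables (H : hilbertType R k) (W : innerProductType R k).
Local Notation K := (RorC R k).

Lemma Riesz_representation (l : H -> K) (D : R) :
  linear_for *%R l -> 0 <= D -> (forall x, rnorm (l x) <= D * rnorm x) ->
  exists u, forall x, l x = inner x u.
Proof.
move=> ll D0 lD; apply: (@coercive_representation _ _ H H id l 1 1 D) => //.
- by move=> x; rewrite mul1r.
- by move=> x; rewrite mul1r.
Qed.

Variables (f : H -> W) (c : R) (lf : linear f) (fc : norm_bound c f).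

(** For a bounded linear map, the Riesz theorem on the domain provides an
    adjoint, so the default value of [adjoint] is not taken. *)
Lemma adjointP x y : inner (f x) y = inner x (adjoint f y).
Proof.
have /choice[g hg] : forall y, exists u, forall x, inner (f x) y = inner x u.
  move=> {}y; apply: (@Riesz_representation _ (`|c| * rnorm y)).
  - by move=> a u v; rewrite lf innerDl innerZl.
  - by rewrite mulr_ge0 ?rnorm_ge0.
  - move=> {}x; apply: le_trans (rnorm_inner_le _ _) _.
    rewrite mulrAC ler_wpM2r ?rnorm_ge0 // (le_trans (fc x)) //.
    by rewrite ler_wpM2r ?rnorm_ge0 ?ler_norm.
have ex : exists h, [set h | forall x y, inner (f x) y = inner x (h y)] h.
  by exists g => x' y'; exact: hg.
exact: (xgetPex (fun=> 0) ex).
Qed.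

Lemma adjoint_linear : linear (adjoint f).
Proof.
move=> a y z; apply: inner_inj => x.
by rewrite -adjointP !innerDr !innerZr -!adjointP.
Qed.

Lemma adjoint_norm_bound : norm_bound (opnorm f) (adjoint f).
Proof.
move=> y; have [->|g0] := eqVneq (adjoint f y) 0.
  by rewrite rnorm0 mulr_ge0 ?rnorm_ge0 ?(opnorm_ge0 fc).
have n0 : 0 < rnorm (adjoint f y).
  by rewrite lt_neqAle eq_sym rnorm_eq0 g0 rnorm_ge0.
rewrite -(ler_pM2l n0) -expr2 -reK_inner_self -adjointP.
apply: le_trans (reK_inner_le _ _) _.
rewrite mulrCA mulrA ler_wpM2r ?rnorm_ge0 //.
exact: norm_bound_opnorm fc _.
Qed.

Lemma opnorm_adjoint : opnorm (adjoint f) = opnorm f.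
Proof.
apply/eqP; rewrite eq_le; apply/andP; split.
  exact: opnorm_le (opnorm_ge0 fc) adjoint_norm_bound.
apply: opnorm_le (opnorm_ge0 adjoint_norm_bound) _ => x.
have [->|f0] := eqVneq (f x) 0.
  by rewrite rnorm0 mulr_ge0 ?rnorm_ge0 ?(opnorm_ge0 adjoint_norm_bound).
have n0 : 0 < rnorm (f x) by rewrite lt_neqAle eq_sym rnorm_eq0 f0 rnorm_ge0.
rewrite -(ler_pM2l n0) -expr2 -reK_inner_self adjointP.
apply: le_trans (reK_inner_le _ _) _.
rewrite mulrC mulrA ler_wpM2r ?rnorm_ge0 // mulrC.
exact: norm_bound_opnorm adjoint_linear adjoint_norm_bound _.
Qed.

End Adjoint.

(** * Square-summable sequences *)

Section Ell2.
Variables (R : realType) (k : scalar_kind).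
Implicit Types a b : ell2 R k.

Lemma ell2_addE a b n : (a + b : ell2 R k) n = a n + b n.
Proof. by []. Qed.

Lemma ell2_subE a b n : (a - b : ell2 R k) n = a n - b n.
Proof. by []. Qed.

Lemma ell2_eqP a b : (forall n, a n = b n) -> a = b.
Proof. by move=> ab; apply: val_inj; apply/funext. Qed.

Lemma ell2_sqr_rnorm a :
  ((rnorm a ^+ 2)%:E = \sum_(0 <= n <oo) (rnorm (a n) ^+ 2)%:E)%E.
Proof.
have ca := is_cvg_sqsummable (ell2_subproof a).
have -> : rnorm a ^+ 2 = limn (series (fun n => rnorm (a n) ^+ 2)).
  apply: (can_inj (@ofRK R k)); rewrite -inner_self.
  apply: (@ell2_innerE _ _ a a).
  rewrite [series _](_ : _ =
    fun n => ofR (series (fun n => rnorm (a n) ^+ 2) n)); last first.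
    apply/funext => n; rewrite /series /= rmorph_sum /=; apply: eq_bigr => i _.
    by rewrite mul_conjK rmorphXn /= ofR_rnorm.
  exact: cvg_ofR.
rewrite -EFin_lim //; congr (limn _); apply/funext => n.
by rewrite /series /= -sumEFin.
Qed.

Lemma inner_delta a n : inner a (delta R k n) = a n.
Proof.
apply: (@ell2_innerE _ _ a (delta R k n)).
apply: cvg_near_cst; exists n.+1 => // m /= nm.
rewrite /series /= (bigD1_seq n) ?iota_uniq ?mem_index_iota //=.
rewrite eqxx rmorph1 mulr1 big1 ?addr0 // => i /negbTE ->.
by rewrite rmorph0 mulr0.
Qed.

End Ell2.

(** * Analysis and synthesis operators *)

Section Analysis.
Variables (R : realType) (k : scalar_kind) (H : hilbertType R k).
Implicit Types (Phi Psi : nat -> H).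

(** A bounded map with the right coordinates identifies a Bessel sequence
    together with its analysis operator. *)
Lemma bessel_analysis_eq Phi (L : H -> ell2 R k) (c : R) :
  norm_bound c L -> (forall f n, L f n = inner f (Phi n)) ->
  bessel Phi /\ analysis Phi = L.
Proof.
move=> Lc LE.
have bPhi : bessel Phi.
  (* a Bessel bound is required to be positive, and [c] may be 0 *)
  exists (c ^+ 2 + 1) => [|f]; first by rewrite ltr_wpDl ?sqr_ge0.
  under eq_eseriesr => n _ do rewrite -LE.
  rewrite -ell2_sqr_rnorm lee_fin mulrDl -exprMn mul1r.
  apply: (@le_trans _ _ ((c * rnorm f) ^+ 2)); last by rewrite lerDl sqr_ge0.
  rewrite ler_pXn2r ?nnegrE ?rnorm_ge0 //.
  exact: le_trans (rnorm_ge0 _) (Lc f).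
split => //; apply/funext => f; apply: ell2_eqP => n.
by rewrite analysisE // LE.
Qed.

Lemma analysis_sqr_rnorm Phi f : bessel Phi ->
  ((rnorm (analysis Phi f) ^+ 2)%:E =
    \sum_(0 <= n <oo) (rnorm (inner f (Phi n)) ^+ 2)%:E)%E.
Proof.
move=> bPhi; rewrite ell2_sqr_rnorm.
by apply: eq_eseriesr => n _; rewrite analysisE.
Qed.

Lemma analysis_linear Phi : bessel Phi -> linear (analysis Phi).
Proof.
move=> bPhi a f g; apply: ell2_eqP => n.
rewrite analysisE // innerDl innerZl.
by rewrite -[RHS]/(a * analysis Phi f n + analysis Phi g n) !analysisE.
Qed.

Lemma analysis_norm_bound Phi : bessel Phi ->
  exists2 c, 0 < c & norm_bound c (analysis Phi).
Proof.
move=> bPhi; have [M M0 PhiM] := bPhi.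
exists (Num.sqrt M) => [|f]; first by rewrite sqrtr_gt0.
rewrite -(@ler_pXn2r _ 2) ?nnegrE ?mulr_ge0 ?rnorm_ge0 ?sqrtr_ge0 //.
rewrite exprMn sqr_sqrtr ?(ltW M0) // -lee_fin analysis_sqr_rnorm //.
Qed.

Lemma lower_boundP Phi (c : R) : bessel Phi -> 0 <= c ->
  lower_bound (c ^+ 2) Phi <-> forall f, c * rnorm f <= rnorm (analysis Phi f).
Proof.
move=> bPhi c0; split => h f; have := h f.
  rewrite -analysis_sqr_rnorm // lee_fin -exprMn.
  by rewrite ler_pXn2r ?nnegrE ?mulr_ge0 ?rnorm_ge0.
rewrite -analysis_sqr_rnorm // lee_fin -exprMn.
by rewrite ler_pXn2r ?nnegrE ?mulr_ge0 ?rnorm_ge0.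
Qed.

Lemma bessel_sub Phi Psi : bessel Phi -> bessel Psi ->
  bessel (Phi - Psi) /\
  analysis (Phi - Psi) = (fun f => analysis Phi f - analysis Psi f).
Proof.
move=> bPhi bPsi.
have [c _ Uc] := analysis_norm_bound bPhi.
have [d _ Ud] := analysis_norm_bound bPsi.
apply: (@bessel_analysis_eq _ _ (c + d)) => [f|f n].
  by rewrite mulrDl (le_trans (ler_rnormB _ _)) // lerD.
by rewrite ell2_subE !analysisE // -innerBr.
Qed.

Section Bessel.
Variables (Phi : nat -> H) (bPhi : bessel Phi).

Lemma analysis_opnorm f :
  rnorm (analysis Phi f) <= opnorm (analysis Phi) * rnorm f.
Proof.
have [c _ Uc] := analysis_norm_bound bPhi.
exact: norm_bound_opnorm (analysis_linear bPhi) Uc _.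
Qed.

Lemma inner_analysis f a :
  inner (analysis Phi f) a = inner f (synthesis Phi a).
Proof.
have [c _ Uc] := analysis_norm_bound bPhi.
exact: adjointP (analysis_linear bPhi) Uc _ _.
Qed.

Lemma synthesis_linear : linear (synthesis Phi).
Proof.
have [c _ Uc] := analysis_norm_bound bPhi.
exact: adjoint_linear (analysis_linear bPhi) Uc.
Qed.

Lemma synthesis_frnorm a : rnorm (synthesis Phi a) <= frnorm Phi * rnorm a.
Proof.
have [c _ Uc] := analysis_norm_bound bPhi.
rewrite /frnorm (opnorm_adjoint (analysis_linear bPhi) Uc).
exact: adjoint_norm_bound (analysis_linear bPhi) Uc _.
Qed.

Lemma frnormE : frnorm Phi = opnorm (analysis Phi).
Proof.
have [c _ Uc] := analysis_norm_bound bPhi.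
exact: opnorm_adjoint (analysis_linear bPhi) Uc.
Qed.

End Bessel.

Lemma synthesis_sub Phi Psi a : bessel Phi -> bessel Psi ->
  synthesis (Phi - Psi) a = synthesis Phi a - synthesis Psi a.
Proof.
move=> bPhi bPsi; have [bD UD] := bessel_sub bPhi bPsi.
apply: inner_inj => x; rewrite innerBr -!inner_analysis //.
by rewrite UD innerBl.
Qed.

End Analysis.

(** * Frames with an explicit lower bound *)

Section Frame.
Variables (R : realType) (k : scalar_kind) (H : hilbertType R k).
Variables (Phi : nat -> H) (bPhi : bessel Phi) (c : R) (c0 : 0 < c).
Hypothesis Uc : forall f, c * rnorm f <= rnorm (analysis Phi f).
Local Notation U := (analysis Phi).
Local Notation T := (synthesis Phi).
Local Notation S := (frame_operator Phi).
Local Notation Sinv := (inv_op (frame_operator Phi)).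

Let lU := analysis_linear bPhi.
Let lT := synthesis_linear bPhi.

Lemma inner_frame_operator f g : inner f (S g) = inner (U f) (U g).
Proof. by rewrite inner_analysis. Qed.

Lemma frame_operator_linear : linear S.
Proof. by move=> a f g; rewrite /frame_operator /= lU lT. Qed.

Lemma frame_operator_inj : injective S.
Proof.
move=> f g Sfg; apply/eqP; rewrite -subr_eq0 -rnorm_eq0 eq_le rnorm_ge0 andbT.
rewrite -(ler_pM2l c0) mulr0; apply: le_trans (Uc _) _.
rewrite -(@ler_pXn2r _ 2) ?nnegrE ?rnorm_ge0 // expr0n /= -reK_inner_self.
rewrite -inner_frame_operator (linear_subE frame_operator_linear).
by rewrite Sfg subrr linear0r raddf0.
Qed.

Lemma frame_operator_surj g : exists f, S f = g.
Proof.
have [d d0 Ud] := analysis_norm_bound bPhi.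
have [u uE] : exists u, forall x, inner x g = inner (U x) (U u).
  apply: (@coercive_representation _ _ _ _ U (inner^~ g) c d (rnorm g)) => //.
  - by move=> a x y; rewrite innerDl innerZl.
  - exact: ltW.
  - exact: rnorm_ge0.
  - by move=> x; rewrite mulrC rnorm_inner_le.
by exists u; apply: inner_inj => x; rewrite inner_frame_operator uE.
Qed.

Lemma inv_frame_operatorK : cancel Sinv S.
Proof.
move=> g; apply: pinvK; rewrite inE.
by have [f <-] := frame_operator_surj g; exists f.
Qed.

Lemma inv_frame_operator_linear : linear Sinv.
Proof.
move=> a f g; apply: frame_operator_inj.
by rewrite frame_operator_linear !inv_frame_operatorK.
Qed.

Lemma inv_frame_operator_selfadjoint f g : inner (Sinv f) g = inner f (Sinv g).
Proof.
rewrite -{1}[g]inv_frame_operatorK inner_frame_operator innerC.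
by rewrite -inner_frame_operator inv_frame_operatorK -innerC.
Qed.

(** The analysis operator [U S^-1] of the canonical dual frame. It is a right
    inverse of the synthesis operator, and [U S^-1 T] is the orthogonal
    projection onto the range of [U]. *)
Definition canonical_dual_analysis (f : H) : ell2 R k := U (Sinv f).
Local Notation G := canonical_dual_analysis.

Lemma canonical_dual_linear : linear G.
Proof.
by move=> a f g; rewrite /canonical_dual_analysis inv_frame_operator_linear lU.
Qed.

Lemma synthesis_canonical_dual f : T (G f) = f.
Proof. exact: inv_frame_operatorK. Qed.

Lemma inner_canonical_dual f a : inner (G f) a = inner (Sinv f) (T a).
Proof. exact: inner_analysis. Qed.

(** With [g = S^-1 f], one has [|U g|^2 = Re <g, f>], and [c |g| <= |U g|]. *)
Lemma canonical_dual_norm_bound : norm_bound c^-1 G.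
Proof.
move=> f; have [->|g0] := eqVneq (G f) 0.
  by rewrite rnorm0 mulr_ge0 ?rnorm_ge0 // invr_ge0 ltW.
have n0 : 0 < rnorm (G f) by rewrite lt_neqAle eq_sym rnorm_eq0 g0 rnorm_ge0.
rewrite mulrC ler_pdivlMr // -(ler_pM2l n0) mulrA -expr2 -reK_inner_self.
rewrite inner_canonical_dual synthesis_canonical_dual.
apply: le_trans (_ : c * (rnorm (Sinv f) * rnorm f) <= _).
  by rewrite mulrC ler_pM2l // reK_inner_le.
by rewrite mulrA ler_wpM2r ?rnorm_ge0 // Uc.
Qed.

(** The projection onto the kernel exists because it is given by this formula,
    so that the projection theorem is not needed. *)
Lemma orthoproj_ker_synthesis a :
  orthoproj (null_space T) a = a - G (T a).
Proof.
have ker0 b : T (b - G (T b)) = 0.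
  by rewrite linear_subE // synthesis_canonical_dual subrr.
have ortho b y : T y = 0 -> inner (b - (b - G (T b))) y = 0.
  by move=> Ty; rewrite opprB addrC subrK inner_canonical_dual Ty linear0r.
have ex : exists p, [set p | null_space T p /\
    forall y, null_space T y -> inner (a - p) y = 0] p.
  exists (a - G (T a)); split; first exact: ker0.
  by move=> y; exact: ortho.
have [] := xgetPex 0 ex; rewrite -/(orthoproj _ a).
set p := orthoproj _ a => Tp op.
(* the difference of two candidates lies in the kernel and is orthogonal to it *)
have Td : T (p - (a - G (T a))) = 0 by rewrite linear_subE // Tp ker0 subrr.
apply/eqP; rewrite -subr_eq0; apply/eqP/(@dot_eq0 _ _ _ inner).
have h1 := ortho a _ Td; have h2 := op _ Td.
move: (a - G (T a)) h1 h2 {Td} => q h1 h2.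
have -> : inner (p - q) (p - q) = inner (a - q) (p - q) - inner (a - p) (p - q).
  by rewrite -innerBl opprB [a - q + _]addrC addrA subrK.
by rewrite h1 h2 subrr.
Qed.

(** [U S^-1 T] is a contraction. *)
Lemma rnorm_range_proj_le a : rnorm (G (T a)) <= rnorm a.
Proof.
have [->|g0] := eqVneq (G (T a)) 0; first by rewrite rnorm0 rnorm_ge0.
have n0 : 0 < rnorm (G (T a)).
  by rewrite lt_neqAle eq_sym rnorm_eq0 g0 rnorm_ge0.
rewrite -(ler_pM2l n0) -expr2 -reK_inner_self.
rewrite inner_canonical_dual synthesis_canonical_dual -inner_canonical_dual.
exact: reK_inner_le.
Qed.

Section ApproxDual.
Variables (Th : H -> ell2 R k) (A : H -> H).
Hypotheses (bTh : bounded_operators Th) (bA : bounded_operators A).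

Lemma approx_dual_analysis : bessel (approx_dual Phi Th A) /\
  analysis (approx_dual Phi Th A) = (fun f => G (A f) + Th f).
Proof.
have /bounded_operatorsP[lTh [t t0 Tht]] := bTh.
have /bounded_operatorsP[lA [a a0 Aa]] := bA.
apply: (@bessel_analysis_eq _ _ _ _ _ (c^-1 * a + t)) => [f|f n].
  rewrite mulrDl (le_trans (ler_rnormD _ _)) // lerD //.
  apply: le_trans (canonical_dual_norm_bound _) _.
  by rewrite -mulrA ler_wpM2l // invr_ge0 ltW.
rewrite ell2_addE /approx_dual innerDr -(adjointP lA Aa) -(adjointP lTh Tht).
rewrite inner_delta /canonical_dual_analysis analysisE //.
by rewrite inv_frame_operator_selfadjoint.
Qed.

End ApproxDual.

End Frame.

(** * Approximate duals of perturbed frames *)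

Section Perturbation.
Variables (R : realType) (k : scalar_kind) (H : hilbertType R k).
Implicit Types (Phi Psi : nat -> H).

Lemma frame_analysis_ge Phi (m : R) : bessel Phi -> 0 < m ->
  lower_bound m Phi ->
  forall f, Num.sqrt m * rnorm f <= rnorm (analysis Phi f).
Proof.
move=> bPhi m0; rewrite -{1}(sqr_sqrtr (ltW m0)).
by move/(lower_boundP bPhi (sqrtr_ge0 m)).
Qed.

Lemma perturbation_analysis_ge Phi Psi (c mu : R) : perturbation mu Phi Psi ->
  (forall f, c * rnorm f <= rnorm (analysis Phi f)) ->
  forall f, (c - mu) * rnorm f <= rnorm (analysis Psi f).
Proof.
move=> [bPhi bPsi le_mu] Uc f; have [bD UD] := bessel_sub bPhi bPsi.
rewrite mulrBl lerBlDr; apply: le_trans (Uc f) _.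
rewrite -[analysis Phi f](subrK (analysis Psi f)) addrC.
apply: le_trans (ler_rnormD _ _) _; rewrite lerD2l.
have := analysis_opnorm bD f; rewrite -(frnormE bD) UD => /le_trans; apply.
by rewrite ler_wpM2r ?rnorm_ge0.
Qed.

Section Frame.
Variables (Psi : nat -> H) (bPsi : bessel Psi) (c : R) (c0 : 0 < c).
Hypothesis Uc : forall f, c * rnorm f <= rnorm (analysis Psi f).
Variables (A : H -> H) (bA : bounded_operators A).
Local Notation T := (synthesis Psi).
Local Notation G := (canonical_dual_analysis Psi).

Lemma approx_dual_synthesis (L : H -> ell2 R k) f : synthesis_ran Psi L ->
  T (analysis (approx_dual Psi L A) f) = A f.
Proof.
move=> [bL TL]; have [_ ->] := approx_dual_analysis bPsi c0 Uc bL bA.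
rewrite (linear_addE (synthesis_linear bPsi)) TL addr0.
exact: (synthesis_canonical_dual bPsi c0 Uc).
Qed.

Lemma approx_dual_approximately_dual (L : H -> ell2 R k) :
  synthesis_ran Psi L -> opnorm (fun f => f - A f) < 1 ->
  approximately_dual Psi (approx_dual Psi L A).
Proof.
move=> LR A1; split.
  by have [] := approx_dual_analysis bPsi c0 Uc LR.1 bA.
rewrite [X in opnorm X](_ : _ = fun f => f - A f) //.
by apply/funext => f; rewrite approx_dual_synthesis.
Qed.

Variables (Xi : nat -> H) (bXi : bessel Xi).

(** The kernel component of the analysis operator of [Xi]. *)
Let Th : H -> ell2 R k := orthoproj (null_space T) \o analysis Xi.

Let ThE f : Th f = analysis Xi f - G (T (analysis Xi f)).
Proof. exact: (orthoproj_ker_synthesis bPsi c0 Uc). Qed.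

Let lG := canonical_dual_linear bPsi c0 Uc.
Let lT := synthesis_linear bPsi.

(** This uses the formula for the projection, which makes it linear and bounded. *)
Lemma ker_proj_analysis_ran : synthesis_ran Psi Th.
Proof.
split; last first.
  move=> f; rewrite ThE (linear_subE lT).
  by rewrite (synthesis_canonical_dual bPsi c0 Uc) subrr.
apply/bounded_operatorsP; split.
  move=> a f g; rewrite !ThE (analysis_linear bXi) lT lG.
  by rewrite scalerBr opprD addrACA.
have [d d0 Ud] := analysis_norm_bound bXi.
exists (2 * d) => [|f]; first by rewrite mulr_gt0.
have GTd := le_trans (rnorm_range_proj_le bPsi c0 Uc (analysis Xi f)) (Ud f).
rewrite ThE; apply: le_trans (ler_rnormB _ _) _.
apply: le_trans (lerD (Ud f) GTd) _.
by rewrite -mulrA [2 * _]mulr_natl mulr2n.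
Qed.

(** Adding the kernel component of [Xi] leaves only the discrepancy in the range
    of the analysis operator of [Psi], which does not depend on the parameter operator. *)
Lemma approx_dual_ker_proj_sub f :
  analysis (approx_dual Psi Th A) f - analysis Xi f =
  G (A f - T (analysis Xi f)).
Proof.
have [_ ->] := approx_dual_analysis bPsi c0 Uc ker_proj_analysis_ran.1 bA.
by rewrite ThE (linear_subE lG) -addrA [_ - _ - _]addrAC subrr add0r.
Qed.

Lemma approx_dual_ker_proj_best L : synthesis_ran Psi L ->
  frnorm (approx_dual Psi Th A - Xi) <= frnorm (approx_dual Psi L A - Xi).
Proof.
move=> LR.
have [bTh _] := approx_dual_analysis bPsi c0 Uc ker_proj_analysis_ran.1 bA.
have [bL _] := approx_dual_analysis bPsi c0 Uc LR.1 bA.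
have [bDT UDT] := bessel_sub bTh bXi; have [bDL UDL] := bessel_sub bL bXi.
have [d _ Ud] := analysis_norm_bound bDL.
rewrite (frnormE bDT) (frnormE bDL); apply: opnorm_le (opnorm_ge0 Ud) _ => f.
apply: le_trans (analysis_opnorm bDL f).
rewrite UDT UDL [X in rnorm X <= _]approx_dual_ker_proj_sub.
rewrite -{1}(approx_dual_synthesis f LR) -(linear_subE lT).
exact: (rnorm_range_proj_le bPsi c0 Uc).
Qed.

Lemma approx_dual_ker_proj_frnorm (e : R) : 0 <= e ->
  norm_bound e (fun f => A f - T (analysis Xi f)) ->
  frnorm (Xi - approx_dual Psi Th A) <= c^-1 * e.
Proof.
move=> e0 he.
have [bTh _] := approx_dual_analysis bPsi c0 Uc ker_proj_analysis_ran.1 bA.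
have [bD UD] := bessel_sub bXi bTh.
rewrite (frnormE bD); apply: opnorm_le => [|f].
  by rewrite mulr_ge0 // invr_ge0 ltW.
rewrite UD rnorm_distrC approx_dual_ker_proj_sub.
apply: le_trans (canonical_dual_norm_bound bPsi c0 Uc _) _.
by rewrite -mulrA ler_wpM2l // invr_ge0 ltW.
Qed.

End Frame.

Lemma synthesis_perturbation_norm_bound Phi Psi (mu : R) a :
  perturbation mu Phi Psi ->
  rnorm (synthesis Phi a - synthesis Psi a) <= mu * rnorm a.
Proof.
move=> [bPhi bPsi le_mu]; rewrite -synthesis_sub //.
have [bD _] := bessel_sub bPhi bPsi.
apply: le_trans (synthesis_frnorm bD a) _.
by rewrite ler_wpM2r ?rnorm_ge0.
Qed.

End Perturbation.

Theorem theorem4p5 (R : realType) (k : scalar_kind) (H : hilbertType R k)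
    (Hsep : separable H) (Phi Psi : nat -> H) (m mu : R)
    (PhiF : frame_with_lower_bound m Phi)
    (mu_gt0 : 0 < mu) (mu_lt : mu < Num.sqrt m)
    (PsiP : perturbation mu Phi Psi) :
  frame_with_lower_bound ((Num.sqrt m - mu) ^+ 2) Psi /\
  forall (Theta : H -> ell2 R k) (A1 A2 : H -> H),
    synthesis_ran Phi Theta ->
    bounded_operators A1 -> opnorm (fun f => f - A1 f) < 1 ->
    bounded_operators A2 -> opnorm (fun f => f - A2 f) < 1 ->
    let Phi_ad := approx_dual Phi Theta A1 in
    let Theta_ba : H -> ell2 R k :=
      orthoproj (null_space (synthesis Psi)) \o analysis Phi_ad in
    let Psi_ad := approx_dual Psi Theta_ba A2 in
    let lambda := mu / (Num.sqrt m - mu) *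
      (opnorm A1 / Num.sqrt m + opnorm Theta +
       opnorm (fun f => A1 f - A2 f) / mu) in
    [/\ approximately_dual Psi Psi_ad,
        best_approximation Psi Theta_ba A2 Phi_ad &
        perturbation lambda Phi_ad Psi_ad].
Proof.
have [M [m0 M0 lowPhi upPhi]] := PhiF; have [bPhi bPsi le_mu] := PsiP.
pose s := Num.sqrt m; have s0 : 0 < s by rewrite sqrtr_gt0.
have UPhi := frame_analysis_ge bPhi m0 lowPhi.
have UPsi := perturbation_analysis_ge PsiP UPhi.
rewrite -/s in mu_lt UPhi UPsi *.
have c0 : 0 < s - mu by rewrite subr_gt0.
split.
  have [N N0 upPsi] := bPsi; exists N; split=> //; first by rewrite exprn_gt0.
  by apply/(lower_boundP bPsi (ltW c0)).
move=> Theta A1 A2 ThR bA1 A1lt bA2 A2lt Phi_ad Theta_ba Psi_ad lambda.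
(* [U_ad = U_Phi S_Phi^-1 A1 + Theta], hence [T_Phi U_ad = A1] *)
have [bad UadE] := approx_dual_analysis bPhi s0 UPhi ThR.1 bA1.
have TUad f : synthesis Phi (analysis Phi_ad f) = A1 f.
  exact: (approx_dual_synthesis bPhi s0 UPhi bA1 f ThR).
have baR := ker_proj_analysis_ran bPsi c0 UPsi bad.
split.
- exact: (approx_dual_approximately_dual bPsi c0 UPsi bA2 baR A2lt).
- split=> [|L LR]; first exact: baR.
  exact: (approx_dual_ker_proj_best bPsi c0 UPsi bA2 bad LR).
have /bounded_operatorsP[lA1 [a1 _ A1b]] := bA1.
have /bounded_operatorsP[lA2 [a2 _ A2b]] := bA2.
have /bounded_operatorsP[lTh [t _ Thb]] := ThR.1.
have lD : linear (fun f => A1 f - A2 f).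
  by move=> a f g; rewrite lA1 lA2 scalerBr opprD addrACA.
have Db : norm_bound (a1 + a2) (fun f => A1 f - A2 f).
  by move=> f; rewrite mulrDl (le_trans (ler_rnormB _ _)) // lerD.
have oD := opnorm_ge0 Db; have oA1 := opnorm_ge0 A1b; have oTh := opnorm_ge0 Thb.
pose e := opnorm (fun f => A1 f - A2 f) + mu * (opnorm A1 / s + opnorm Theta).
have -> : lambda = (s - mu)^-1 * e.
  by rewrite /lambda /e -/s; field; rewrite !gt_eqF.
have [bPsi_ad _] := approx_dual_analysis bPsi c0 UPsi baR.1 bA2.
split; [exact: bad | exact: bPsi_ad |].
apply: (approx_dual_ker_proj_frnorm bPsi c0 UPsi bA2 bad).
  by rewrite addr_ge0 // mulr_ge0 ?(ltW mu_gt0) // addr_ge0 // divr_ge0 // ltW.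
move=> f; rewrite /e mulrDl.
(* compare [A2] with [T_Psi U_ad] through [A1 = T_Phi U_ad] *)
have -> : A2 f - synthesis Psi (analysis Phi_ad f) =
    (synthesis Phi (analysis Phi_ad f) - synthesis Psi (analysis Phi_ad f))
    - (A1 f - A2 f).
  by rewrite TUad opprB [RHS]addrC -addrA (addrA (- _)) addNr add0r.
apply: le_trans (ler_rnormB _ _) _; rewrite addrC lerD //.
  exact: norm_bound_opnorm lD Db _.
apply: le_trans (synthesis_perturbation_norm_bound _ PsiP) _.
rewrite -mulrA ler_wpM2l ?(ltW mu_gt0) // UadE mulrDl.
apply: le_trans (ler_rnormD _ _) _; rewrite lerD //; last first.
  exact: norm_bound_opnorm lTh Thb _.
apply: le_trans (canonical_dual_norm_bound bPhi s0 UPhi _) _.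
rewrite [_ / s]mulrC -mulrA ler_wpM2l ?invr_ge0 ?(ltW s0) //.
exact: norm_bound_opnorm lA1 A1b _.
Qed.
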